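(* Let $H$ be a commutative Hopf algebra with antipode $S$. If $B$ is a Rota-Baxter co-operator on the Hopf algebra $H$ satisfying $S\circ B=B\circ S$, then $B$ is also a Rota-Baxter operator on the Hopf heap $Hp(H,[-,-,-])$, where $[a,b,c]=aS(b)c$ for $a,b,c\in H$.
   Context: Everything is over a fixed field $\mathbf{k}$. Sweedler notation $\Delta(c)=c_1\otimes c_2$ (iterated: $c_1\otimes c_2\otimes c_3\otimes c_4$) is used; $C^{cop}$ is the co-opposite coalgebra. A Rota-Baxter co-operator on a commutative Hopf algebra $H$ is an algebra map $B:H\to H$ with $B(x_1)\otimes B(x_2)=B(x)_1B(B(x)_2S(B(x)_4))\otimes B(x)_3$ for all $x\in H$. A Hopf heap is a coalgebra $C$ with a coalgebra map $C\otimes C^{cop}\otimes C\to C$, $a\otimes b\otimes c\mapsto[a,b,c]$, such that $[[a,b,c],d,h]=[a,b,[c,d,h]]$ and $[c_1,c_2,a]=[a,c_1,c_2]=\varepsilon(c)a$ for all $a,b,c,d,h\in C$. For a Hopf algebra $H$ with antipode $S$, $Hp(H,[-,-,-])$ is the Hopf heap on the coalgebra $H$ with $[a,b,c]=aS(b)c$. A Rota-Baxter operator on a Hopf heap $C$ is a linear map $B:C\to C$ with $B([a,b,c])=[B(a),B(b),B(c)]$ and $B(a_1)\otimes B(a_2)=[B(a)_1,B(B(a)_4),B(B(a)_2)]\otimes B(a)_3$ for all $a,b,c\in C$. *)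

(* Defs.v *)
From HB Require Import structures.
From mathcomp Require Import all_boot all_order all_algebra.
From mathcomp Require Import boolp.

Set Implicit Arguments.
Unset Strict Implicit.
Unset Printing Implicit Defensive.

Import GRing.Theory.
Local Open Scope ring_scope.
Local Open Scope quotient_scope.

Reserved Notation "v '\ot' w" (at level 40, left associativity).

Section TensorProduct.
Variables (k : fieldType) (V W : lmodType k).
Implicit Types (s t : seq (V * W)) (v : V) (w : W) (a : k).

(* The list [:: (v1, w1); .. ; (vn, wn)] stands for the formal sum
   v1 (x) w1 + .. + vn (x) wn. The relation below is the least congruence on
   the free commutative monoid on V * W that makes (v, w) |-> v (x) w
   bilinear and balanced. *)
Inductive tensor_eq : seq (V * W) -> seq (V * W) -> Prop :=
| tensor_eq_refl s : tensor_eq s s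
| tensor_eq_sym s t : tensor_eq s t -> tensor_eq t s
| tensor_eq_trans s t u : tensor_eq s t -> tensor_eq t u -> tensor_eq s u
| tensor_eq_cat s s' t t' :
    tensor_eq s s' -> tensor_eq t t' -> tensor_eq (s ++ t) (s' ++ t')
| tensor_eq_catC s t : tensor_eq (s ++ t) (t ++ s)
| tensor_eq_0l w : tensor_eq [:: (0, w)] [::]
| tensor_eq_Dl v v' w : tensor_eq [:: (v + v', w)] [:: (v, w); (v', w)]
| tensor_eq_Dr v w w' : tensor_eq [:: (v, w + w')] [:: (v, w); (v, w')]
| tensor_eq_Z a v w : tensor_eq [:: (a *: v, w)] [:: (v, a *: w)].

Definition tensor_eqb s t : bool := `[< tensor_eq s t >].

Fact tensor_eqb_refl : reflexive tensor_eqb.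
Proof. by move=> s; apply/asboolP; exact: tensor_eq_refl. Qed.
Fact tensor_eqb_sym : symmetric tensor_eqb.
Proof. by move=> s t; apply/asboolP/asboolP; exact: tensor_eq_sym. Qed.
Fact tensor_eqb_trans : transitive tensor_eqb.
Proof.
move=> t s u /asboolP st /asboolP tu; apply/asboolP.
exact: tensor_eq_trans tu.
Qed.

Definition tensor_equiv :=
  EquivRel tensor_eqb tensor_eqb_refl tensor_eqb_sym tensor_eqb_trans.

Definition tensor : Type := {eq_quot tensor_equiv}.
HB.instance Definition _ := Choice.on tensor.
HB.instance Definition _ := EqQuotient.on tensor.

Lemma tensor_piP s t : tensor_eq s t <-> \pi_tensor s = \pi_tensor t.
Proof.
split=> [st|/eqmodP/asboolP//].
by apply/eqmodP/asboolP.
Qed.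

Lemma tensor_repr s : tensor_eq (repr (\pi_tensor s)) s.
Proof. by apply/tensor_piP; rewrite reprK. Qed.

Let sc a s := [seq (a *: p.1, p.2) | p <- s].

Lemma tensor_eq_scale a s t : tensor_eq s t -> tensor_eq (sc a s) (sc a t).
Proof.
elim=> {s t} [s|s t _ IH|s t u _ IH1 _ IH2|s s' t t' _ IH1 _ IH2|s t|w|v v' w
             |v w w'|b v w] /=.
- exact: tensor_eq_refl.
- exact: tensor_eq_sym.
- exact: tensor_eq_trans IH2.
- by rewrite /sc !map_cat; exact: tensor_eq_cat.
- by rewrite /sc !map_cat; exact: tensor_eq_catC.
- by rewrite scaler0; exact: tensor_eq_0l.
- by rewrite scalerDr; exact: tensor_eq_Dl.
- exact: tensor_eq_Dr.
- rewrite scalerA mulrC -scalerA; exact: tensor_eq_Z.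
Qed.

Definition tensor_zero : tensor := \pi_tensor [::].
Fact tensor_add_key : unit. Proof. by []. Qed.
Definition tensor_add : tensor -> tensor -> tensor :=
  locked_with tensor_add_key (fun x y => \pi_tensor (repr x ++ repr y)).
Fact tensor_scale_key : unit. Proof. by []. Qed.
Definition tensor_scale : k -> tensor -> tensor :=
  locked_with tensor_scale_key
    (fun a x => \pi_tensor [seq (a *: p.1, p.2) | p <- repr x]).
Definition tensor_opp (x : tensor) : tensor := tensor_scale (-1) x.

Let addE s t : tensor_add (\pi_tensor s) (\pi_tensor t) = \pi_tensor (s ++ t).
Proof.
rewrite /tensor_add unlock; by apply/tensor_piP/tensor_eq_cat; exact: tensor_repr. Qed.

Let scaleE a s : tensor_scale a (\pi_tensor s) = \pi_tensor (sc a s).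
Proof.
rewrite /tensor_scale unlock; by apply/tensor_piP/tensor_eq_scale; exact: tensor_repr. Qed.

Fact tensor_addA : associative tensor_add.
Proof.
move=> x y z; rewrite -(reprK x) -(reprK y) -(reprK z).
by rewrite !addE catA.
Qed.

Fact tensor_addC : commutative tensor_add.
Proof.
move=> x y; rewrite -(reprK x) -(reprK y) !addE.
by apply/tensor_piP; exact: tensor_eq_catC.
Qed.

Fact tensor_add0 : left_id tensor_zero tensor_add.
Proof. by move=> x; rewrite -(reprK x) addE. Qed.

Let scaleDl a b s :
  \pi_tensor (sc (a + b) s) = tensor_add (\pi_tensor (sc a s)) (\pi_tensor (sc b s)).
Proof.
elim: s => [|[v w] s IH]; first by rewrite /= addE.
rewrite -cat1s /sc !map_cat -!addE -/(sc _ _) IH /=.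
have -> : \pi_tensor [:: ((a + b) *: v, w)] =
    tensor_add (\pi_tensor [:: (a *: v, w)]) (\pi_tensor [:: (b *: v, w)]).
  rewrite addE /= scalerDl; apply/tensor_piP; exact: tensor_eq_Dl.
rewrite !tensor_addA; congr (tensor_add _ _).
by rewrite -!tensor_addA (tensor_addC (\pi_tensor [:: (b *: v, w)])).
Qed.

Let scale0 s : \pi_tensor (sc 0 s) = tensor_zero.
Proof.
elim: s => [//|[v w] s IH]; rewrite -cat1s /sc map_cat -addE -/(sc _ _) IH /=.
rewrite scale0r (_ : \pi_tensor [:: (0, w)] = tensor_zero) ?tensor_add0 //.
by apply/tensor_piP; exact: tensor_eq_0l.
Qed.

Let sc1 s : sc 1 s = s.
Proof. by rewrite /sc -[RHS]map_id; apply: eq_map => -[v w]; rewrite scale1r. Qed.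

Fact tensor_addN : left_inverse tensor_zero tensor_opp tensor_add.
Proof.
move=> x; rewrite /tensor_opp -(reprK x) scaleE.
by rewrite -{2}[repr x]sc1 -scaleDl addNr scale0.
Qed.

HB.instance Definition _ :=
  GRing.isZmodule.Build tensor tensor_addA tensor_addC tensor_add0 tensor_addN.

Fact tensor_scaleA a b x :
  tensor_scale a (tensor_scale b x) = tensor_scale (a * b) x.
Proof.
rewrite -(reprK x) !scaleE /sc -map_comp; congr (\pi_tensor _).
by apply: eq_map => -[v w] /=; rewrite scalerA.
Qed.

Fact tensor_scale1 : left_id 1 tensor_scale.
Proof. by move=> x; rewrite -(reprK x) scaleE sc1. Qed.

Fact tensor_scaleDr : right_distributive tensor_scale +%R.
Proof.
move=> a x y; rewrite -(reprK x) -(reprK y) -[_ + _]/(tensor_add _ _).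
by rewrite -[in RHS]/(tensor_add _ _) !(addE, scaleE) /sc map_cat.
Qed.

Fact tensor_scaleDl x : {morph tensor_scale^~ x : a b / a + b}.
Proof. by move=> a b /=; rewrite -(reprK x) !scaleE scaleDl. Qed.

HB.instance Definition _ := GRing.Zmodule_isLmodule.Build k tensor
  tensor_scaleA tensor_scale1 tensor_scaleDr tensor_scaleDl.

Lemma tensor_pi_add s t :
  \pi_tensor s + \pi_tensor t = \pi_tensor (s ++ t) :> tensor.
Proof. exact: addE. Qed.

Lemma tensor_pi_scale a s :
  a *: (\pi_tensor s : tensor) = \pi_tensor [seq (a *: p.1, p.2) | p <- s].
Proof. exact: scaleE. Qed.

Definition tens v w : tensor := \pi_tensor [:: (v, w)].

Local Notation "v \ot w" := (tens v w).

Lemma linear_tensl w : linear (tens^~ w).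
Proof.
move=> a u v; rewrite /tens -[a *: \pi_tensor _]/(tensor_scale a _) scaleE.
rewrite -[X in _ = X]/(tensor_add _ _) addE /=.
by apply/tensor_piP; exact: tensor_eq_Dl.
Qed.

Lemma linear_tensr v : linear (tens v).
Proof.
move=> a u w; rewrite /tens -[a *: \pi_tensor _]/(tensor_scale a _) scaleE.
rewrite -[X in _ = X]/(tensor_add _ _) addE /=; apply/tensor_piP.
apply: tensor_eq_trans (tensor_eq_Dr _ _ _) _.
rewrite -cat1s -[X in tensor_eq _ X]cat1s.
apply: tensor_eq_cat; last exact: tensor_eq_refl.
exact/tensor_eq_sym/tensor_eq_Z.
Qed.

Lemma tensor_sum (x : tensor) : x = \sum_(p <- repr x) p.1 \ot p.2.
Proof.
rewrite -[LHS]reprK; elim: (repr x) => [|[v w] s IH]; first by rewrite big_nil.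
by rewrite big_cons -IH -cat1s -addE.
Qed.

End TensorProduct.

Notation "v \ot w" := (tens v w) : ring_scope.

Definition bilin (k : fieldType) (V W U : lmodType k) (f : V -> W -> U) : Prop :=
  (forall w, linear (f^~ w)) /\ (forall v, linear (f v)).

(* tlift f t is the sum of the f t_1 t_2 for t = sum of the t_1 (x) t_2. It is
   computed on a chosen representative of t, hence it only makes sense for a
   bilinear f: it is then the linear map V (x) W -> U induced by f
   (lemmas linear_tlift, tliftE and tensor_ext). *)
Definition tlift (k : fieldType) (V W U : lmodType k) (f : V -> W -> U)
    (t : tensor V W) : U :=
  \sum_(p <- repr t) f p.1 p.2.

Section TensorUniversal.
Variable (k : fieldType).
Implicit Types (V W U : lmodType k).

Lemma linearD_of V U (f : V -> U) : linear f -> {morph f : u v / u + v}.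
Proof. by move=> lf u v; rewrite -{1}[u]scale1r lf scale1r. Qed.

Lemma linear0_of V U (f : V -> U) : linear f -> f 0 = 0.
Proof. by move=> lf; have := lf (-1) 0 0; rewrite scaler0 addr0 scaleN1r addNr. Qed.

Lemma linearZ_of V U (f : V -> U) a : linear f -> {morph f : u / a *: u}.
Proof. by move=> lf u; rewrite -[a *: u]addr0 lf linear0_of // addr0. Qed.

Let tliftP V W U (f : V -> W -> U) s t : bilin f -> tensor_eq s t ->
  \sum_(p <- s) f p.1 p.2 = \sum_(p <- t) f p.1 p.2.
Proof.
case=> fl fr; elim=> {s t} //.
- by move=> s t u _ -> _ ->.
- by move=> s s' t t' _ IH1 _ IH2; rewrite !big_cat /= IH1 IH2.
- by move=> s t; rewrite !big_cat; exact: addrC.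
- by move=> w; rewrite big_seq1 big_nil; exact: (linear0_of (fl w)).
- move=> v v' w; rewrite !(big_cons, big_nil) !addr0; exact: (linearD_of (fl w)).
- move=> v w w'; rewrite !(big_cons, big_nil) !addr0; exact: (linearD_of (fr v)).
- move=> a v w; rewrite !big_seq1 /=.
  by rewrite (linearZ_of _ (fl w)) (linearZ_of _ (fr v)).
Qed.

Lemma tliftE V W U (f : V -> W -> U) v w : bilin f -> tlift f (v \ot w) = f v w.
Proof. by move=> fb; rewrite /tlift /tens (tliftP fb (tensor_repr _)) big_seq1. Qed.

Lemma linear_tlift V W U (f : V -> W -> U) : bilin f -> linear (tlift f).
Proof.
move=> fb a x y; rewrite /tlift -{1}(reprK x) -{1}(reprK y).
rewrite tensor_pi_scale tensor_pi_add (tliftP fb (tensor_repr _)) big_cat /=.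
rewrite big_map /= scaler_sumr; congr (_ + _).
by apply: eq_bigr => p _; rewrite (linearZ_of _ (fb.1 _)).
Qed.

Lemma linear_sumr V U (f : V -> U) I r (F : I -> V) : linear f ->
  f (\sum_(i <- r) F i) = \sum_(i <- r) f (F i).
Proof. by move=> lf; rewrite (big_morph f (linearD_of lf) (linear0_of lf)). Qed.

Lemma tensor_ext V W U (f g : tensor V W -> U) : linear f -> linear g ->
  (forall v w, f (v \ot w) = g (v \ot w)) -> f =1 g.
Proof.
move=> lf lg fg t; rewrite (tensor_sum t) !linear_sumr //.
by apply: eq_bigr => p _; exact: fg.
Qed.
End TensorUniversal.

Section LinearClosure.
Variables (k : fieldType) (V U : lmodType k).

Lemma lin_id : linear (fun x : V => x).
Proof. by []. Qed.

Lemma lin_app (W : lmodType k) (f : {linear U -> W}) (g : V -> U) :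
  linear g -> linear (fun x => f (g x)).
Proof. by move=> lg a x y; rewrite lg linearP. Qed.

Lemma lin_tensl (W : lmodType k) (g : V -> U) (w : W) :
  linear g -> linear (fun x => g x \ot w).
Proof. by move=> lg a x y; rewrite lg linear_tensl. Qed.

Lemma lin_tensr (W : lmodType k) (g : V -> U) (w : W) :
  linear g -> linear (fun x => w \ot g x).
Proof. by move=> lg a x y; rewrite lg linear_tensr. Qed.

Lemma lin_scaler (g : V -> U) a : linear g -> linear (fun x => a *: g x).
Proof. by move=> lg b x y; rewrite lg scalerDr !scalerA mulrC. Qed.

Lemma lin_scalel (W : lmodType k) (f : {scalar U}) (g : V -> U) (u : W) :
  linear g -> linear (fun x => f (g x) *: u).
Proof. by move=> lg b x y; rewrite lg linearP scalerDl scalerA. Qed.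

Lemma lin_tliftf (W1 W2 : lmodType k) (F : V -> W1 -> W2 -> U) t :
  (forall a b, linear (fun x => F x a b)) -> linear (fun x => tlift (F x) t).
Proof.
move=> lF a x y; rewrite /tlift scaler_sumr -big_split /=.
by apply: eq_bigr => p _; rewrite lF.
Qed.

Lemma lin_tliftt (W1 W2 : lmodType k) (F : W1 -> W2 -> U)
    (g : V -> tensor W1 W2) :
  bilin F -> linear g -> linear (fun x => tlift F (g x)).
Proof. by move=> bF lg a x y; rewrite lg linear_tlift. Qed.

End LinearClosure.

Lemma lin_mull (k : fieldType) (V : lmodType k) (A : algType k) (g : V -> A) b :
  linear g -> linear (fun x => g x * b).
Proof. by move=> lg a x y; rewrite lg mulrDl scalerAl. Qed.

Lemma lin_mulr (k : fieldType) (V : lmodType k) (A : algType k) (g : V -> A) b :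
  linear g -> linear (fun x => b * g x).
Proof. by move=> lg a x y; rewrite lg mulrDr scalerAr. Qed.

Lemma tensZ (k : fieldType) (V W : lmodType k) a b (v : V) (w : W) :
  (a *: v) \ot (b *: w) = (a * b) *: (v \ot w).
Proof.
rewrite (linearZ_of a (linear_tensl (b *: w))).
by rewrite (linearZ_of b (linear_tensr v)) scalerA.
Qed.

Ltac lin_step :=
  cbv beta;
  lazymatch goal with
  | |- bilin _ => split => ?
  | |- forall _, _ => move=> ?
  | _ => first
    [ exact: lin_id | exact: linearP | apply: lin_tensl | apply: lin_tensr
    | apply: lin_mull | apply: lin_mulr | apply: lin_scalel | apply: lin_scaler
    | apply: lin_tliftf | apply: lin_tliftt | apply: lin_app ]
  end.
Ltac lin := solve [repeat first [assumption | match goal with H : _ |- _ => exact: H end | lin_step]].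

Lemma eq_tlift (k : fieldType) (V W U : lmodType k) (f g : V -> W -> U) t :
  (forall v w, f v w = g v w) -> tlift f t = tlift g t.
Proof. by move=> fg; apply: eq_bigr => p _; exact: fg. Qed.

Lemma linear_sub_tlift (k : fieldType) (V W U U' : lmodType k) (h : U -> U')
    (f : V -> W -> U) t :
  linear h -> h (tlift f t) = tlift (fun v w => h (f v w)) t.
Proof. by move=> lh; rewrite /tlift linear_sumr. Qed.

Lemma tlift_tlift (k : fieldType) (V W V' W' U : lmodType k)
    (g : V' -> W' -> U) (f : V -> W -> tensor V' W') t :
  bilin g -> tlift g (tlift f t) = tlift (fun v w => tlift g (f v w)) t.
Proof. by move=> bg; apply: linear_sub_tlift; exact: linear_tlift. Qed.

Lemma tliftC (k : fieldType) (V W V' W' U : lmodType k)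
    (f : V -> W -> V' -> W' -> U) t t' :
  tlift (fun v w => tlift (f v w) t') t =
  tlift (fun v' w' => tlift (fun v w => f v w v' w') t) t'.
Proof. exact: exchange_big. Qed.

(* comulA reads c_11 (x) (c_12 (x) c_2) = c_1 (x) (c_21 (x) c_22). *)
HB.mixin Record Lmodule_isCoalgebra (k : fieldType) C of GRing.Lmodule k C := {
  comul : {linear C -> tensor C C};
  counit : {scalar C};
  comulA : forall c : C,
    tlift (fun a b => tlift (fun a1 a2 => a1 \ot (a2 \ot b)) (comul a)) (comul c)
    = tlift (fun a b => a \ot comul b) (comul c);
  counitl : forall c : C, tlift (fun a b => counit a *: b) (comul c) = c;
  counitr : forall c : C, tlift (fun a b => counit b *: a) (comul c) = c
}.
#[short(type="coalgType")]
HB.structure Definition Coalgebra (k : fieldType) :=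
  {C of GRing.Lmodule k C & Lmodule_isCoalgebra k C}.

Section Sweedler.
Variables (k : fieldType) (C : coalgType k) (U : lmodType k).

(* sweedler2 f c = f c_1 c_2, sweedler3 f c = f c_1 c_2 c_3, etc., for a
   multilinear f. *)
Definition sweedler2 (f : C -> C -> U) (c : C) : U := tlift f (comul c).
Definition sweedler3 (f : C -> C -> C -> U) : C -> U :=
  sweedler2 (fun c1 => sweedler2 (f c1)).
Definition sweedler4 (f : C -> C -> C -> C -> U) : C -> U :=
  sweedler2 (fun c1 => sweedler3 (f c1)).

Lemma sweedler3E (f : C -> C -> C -> U) c :
  (forall a b, linear (f a b)) -> (forall a b, linear (fun x => f a x b)) ->
  (forall a b, linear (fun x => f x a b)) ->
  sweedler3 f c = sweedler2 (fun a b => sweedler2 (fun a1 a2 => f a1 a2 b) a) c.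
Proof.
move=> f3 f2 f1; rewrite /sweedler3 /sweedler2.
have bf a : bilin (f a) by split.
have bg : bilin (fun a (t : tensor C C) => tlift (f a) t) by lin.
have := congr1 (tlift (fun a (t : tensor C C) => tlift (f a) t)) (comulA c).
rewrite [RHS]tlift_tlift // [LHS]tlift_tlift // => E.
transitivity (tlift (fun v w => tlift (fun a => [eta tlift (f a)]) (v \ot comul w))
  (comul c)).
  by apply: eq_tlift => a b; rewrite tliftE.
rewrite -E; apply: eq_tlift => a b; rewrite tlift_tlift //.
by apply: eq_tlift => a1 a2; rewrite tliftE // tliftE.
Qed.
End Sweedler.

Definition coalg_morphism (k : fieldType) (C D : coalgType k) (f : C -> D) :=
  [/\ linear f,
      forall c, comul (f c) = sweedler2 (fun c1 c2 => f c1 \ot f c2) c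
    & forall c, counit (f c) = counit c].

Definition cop (C : Type) : Type := C.

Section CoOpposite.
Variables (k : fieldType) (C : coalgType k).
HB.instance Definition _ := GRing.Lmodule.on (cop C).

Definition cop_comul (c : cop C) : tensor (cop C) (cop C) :=
  tlift (fun c1 c2 : C => (c2 : cop C) \ot (c1 : cop C)) (comul (c : C)).

Fact cop_comul_linear : linear cop_comul.
Proof. rewrite /cop_comul; lin. Qed.
HB.instance Definition _ :=
  GRing.isLinear.Build k (cop C) (tensor (cop C) (cop C)) _ cop_comul cop_comul_linear.

Let cop_comulE (U : lmodType k) (f : cop C -> cop C -> U) c : bilin f ->
  tlift f (cop_comul c) = sweedler2 (fun c1 c2 : C => f c2 c1) (c : C).
Proof.
move=> bf; rewrite /cop_comul tlift_tlift //.
by apply: eq_tlift => a b; rewrite tliftE.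
Qed.

Fact cop_comulA (c : cop C) :
  tlift (fun a b => tlift (fun a1 a2 => a1 \ot (a2 \ot b)) (cop_comul a))
    (cop_comul c) =
  tlift (fun a b => a \ot cop_comul b) (cop_comul c).
Proof.
rewrite !cop_comulE; try lin.
transitivity (sweedler3 (fun a b d : C =>
   (d : cop C) \ot ((b : cop C) \ot (a : cop C))) (c : C)).
  apply: eq_tlift => a b; rewrite cop_comulE //; lin.
rewrite sweedler3E; try lin.
apply: eq_tlift => a b; rewrite /cop_comul linear_sub_tlift //; lin.
Qed.

Fact cop_counitl (c : cop C) :
  tlift (fun a b : cop C => counit (a : C) *: b) (cop_comul c) = c.
Proof. rewrite cop_comulE; [exact: counitr | lin]. Qed.

Fact cop_counitr (c : cop C) :
  tlift (fun a b : cop C => counit (b : C) *: a) (cop_comul c) = c.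
Proof. rewrite cop_comulE; [exact: counitl | lin]. Qed.

HB.instance Definition _ := Lmodule_isCoalgebra.Build k (cop C)
  cop_comulA cop_counitl cop_counitr.

Lemma sweedler2_cop (U : lmodType k) (f : cop C -> cop C -> U) (c : C) : bilin f ->
  sweedler2 f (c : cop C) = sweedler2 (fun c1 c2 : C => f c2 c1) c.
Proof. exact: cop_comulE. Qed.
End CoOpposite.

Section TensorCoalgebra.
Variables (k : fieldType) (C D : coalgType k).
Local Notation CD := (tensor C D).

Definition tensor_comul (t : CD) : tensor CD CD :=
  tlift (fun c d => sweedler2 (fun c1 c2 =>
    sweedler2 (fun d1 d2 => (c1 \ot d1) \ot (c2 \ot d2)) d) c) t.

Definition tensor_counit (t : CD) : k^o :=
  tlift (k := k) (U := k^o) (fun c d => counit c * counit d) t.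

Let tensor_comul_bilin : bilin (fun (c : C) (d : D) => sweedler2 (fun c1 c2 =>
    sweedler2 (fun d1 d2 => (c1 \ot d1) \ot (c2 \ot d2)) d) c).
Proof. by rewrite /sweedler2; lin. Qed.

Let tensor_counit_bilin :
  bilin (fun (c : C) (d : D) => counit c * counit d : k^o).
Proof.
split=> [d|c] a u v; rewrite linearP; first by rewrite mulrDl -mulrA.
by rewrite mulrDr mulrCA.
Qed.

Fact tensor_comul_linear : linear tensor_comul.
Proof. exact: linear_tlift. Qed.
HB.instance Definition _ :=
  GRing.isLinear.Build k CD (tensor CD CD) _ tensor_comul tensor_comul_linear.

Fact tensor_counit_linear : scalar tensor_counit.
Proof. exact: (linear_tlift (k := k) (U := k^o) tensor_counit_bilin). Qed.
HB.instance Definition _ :=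
  GRing.isLinear.Build k CD k _ tensor_counit tensor_counit_linear.

Let tensor_comulE (U : lmodType k) (f : CD -> CD -> U) c d : bilin f ->
  tlift f (tensor_comul (c \ot d)) =
  sweedler2 (fun c1 c2 => sweedler2 (fun d1 d2 => f (c1 \ot d1) (c2 \ot d2)) d) c.
Proof.
move=> bf; rewrite /tensor_comul tliftE // tlift_tlift //.
apply: eq_tlift => a b; rewrite tlift_tlift //.
by apply: eq_tlift => a' b'; rewrite tliftE.
Qed.

Fact tensor_comulA (t : CD) :
  tlift (fun a b => tlift (fun a1 a2 => a1 \ot (a2 \ot b)) (tensor_comul a))
    (tensor_comul t) =
  tlift (fun a b => a \ot tensor_comul b) (tensor_comul t).
Proof.
move: t; apply: tensor_ext; try lin.
move=> c d; rewrite !tensor_comulE; try lin.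
transitivity (sweedler2 (fun c1 c2 => sweedler2 (fun d1 d2 =>
  sweedler2 (fun c11 c12 => sweedler2 (fun d11 d12 =>
    (c11 \ot d11) \ot ((c12 \ot d12) \ot (c2 \ot d2))) d1) c1) d) c).
  apply: eq_tlift => c1 c2; apply: eq_tlift => d1 d2.
  by rewrite tensor_comulE //; lin.
transitivity (sweedler2 (fun c1 c2 => sweedler2 (fun d1 d2 =>
  sweedler2 (fun c21 c22 => sweedler2 (fun d21 d22 =>
    (c1 \ot d1) \ot ((c21 \ot d21) \ot (c22 \ot d22))) d2) c2) d) c); last first.
  apply: eq_tlift => c1 c2; apply: eq_tlift => d1 d2.
  rewrite /tensor_comul tliftE // linear_sub_tlift; last by lin.
  by apply: eq_tlift => c21 c22; rewrite linear_sub_tlift //; lin.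
transitivity (sweedler3 (fun c1 c2 c3 => sweedler3 (fun d1 d2 d3 =>
    (c1 \ot d1) \ot ((c2 \ot d2) \ot (c3 \ot d3))) d) c).
  rewrite sweedler3E; try by rewrite /sweedler3 /sweedler2; lin.
  apply: eq_tlift => c1 c2; rewrite [LHS]tliftC; apply: eq_tlift => c11 c12.
  by rewrite sweedler3E; try lin.
by apply: eq_tlift => c1 c2; rewrite [LHS]tliftC.
Qed.

Fact tensor_counitl (t : CD) :
  tlift (fun a b => tensor_counit a *: b) (tensor_comul t) = t.
Proof.
move: t; apply: tensor_ext; try lin.
move=> c d; rewrite tensor_comulE; last by lin.
rewrite -[in RHS](counitl c) -[in RHS](counitl d).
rewrite [RHS](linear_sub_tlift (h := fun x => x \ot _)); last by lin.
apply: eq_tlift => c1 c2; rewrite [RHS]linear_sub_tlift; last by lin.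
by apply: eq_tlift => d1 d2; rewrite /tensor_counit tliftE // tensZ.
Qed.

Fact tensor_counitr (t : CD) :
  tlift (fun a b => tensor_counit b *: a) (tensor_comul t) = t.
Proof.
move: t; apply: tensor_ext; try lin.
move=> c d; rewrite tensor_comulE; last by lin.
rewrite -[in RHS](counitr c) -[in RHS](counitr d).
rewrite [RHS](linear_sub_tlift (h := fun x => x \ot _)); last by lin.
apply: eq_tlift => c1 c2; rewrite [RHS]linear_sub_tlift; last by lin.
by apply: eq_tlift => d1 d2; rewrite /tensor_counit tliftE // tensZ.
Qed.

HB.instance Definition _ := Lmodule_isCoalgebra.Build k CD
  tensor_comulA tensor_counitl tensor_counitr.

Lemma sweedler2_tens (U : lmodType k) (f : CD -> CD -> U) (c : C) (d : D) :
  bilin f ->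
  sweedler2 f (c \ot d) =
  sweedler2 (fun c1 c2 => sweedler2 (fun d1 d2 => f (c1 \ot d1) (c2 \ot d2)) d) c.
Proof. exact: tensor_comulE. Qed.

Lemma counit_tens (c : C) (d : D) :
  counit (c \ot d : CD) = counit c * counit d.
Proof. exact: (tliftE (U := k^o) _ _ tensor_counit_bilin). Qed.
End TensorCoalgebra.

Definition tensor_mul (k : fieldType) (A B : algType k) (s t : tensor A B) :
    tensor A B :=
  tlift (fun a b => tlift (fun a' b' => (a * a') \ot (b * b')) t) s.

HB.mixin Record Coalgebra_isBialgebra (k : fieldType) H
    of GRing.Algebra k H & Coalgebra k H := {
  comulM : forall x y : H, comul (x * y) = tensor_mul (comul x) (comul y);
  comul1 : comul (1 : H) = 1 \ot 1;
  counitM : forall x y : H, counit (x * y) = counit x * counit y;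
  counit1 : counit (1 : H) = 1
}.
#[short(type="bialgType")]
HB.structure Definition Bialgebra (k : fieldType) :=
  {H of GRing.Algebra k H & Coalgebra k H & Coalgebra_isBialgebra k H}.

HB.mixin Record Bialgebra_isHopf (k : fieldType) H of Bialgebra k H := {
  antipode : {linear H -> H};
  antipodel : forall x : H,
    tlift (fun a b => antipode a * b) (comul x) = (counit x)%:A;
  antipoder : forall x : H,
    tlift (fun a b => a * antipode b) (comul x) = (counit x)%:A
}.
#[short(type="hopfAlgType")]
HB.structure Definition HopfAlgebra (k : fieldType) :=
  {H of Bialgebra k H & Bialgebra_isHopf k H}.

#[short(type="comHopfAlgType")]
HB.structure Definition ComHopfAlgebra (k : fieldType) :=
  {H of GRing.ComAlgebra k H & HopfAlgebra k H}.

HB.mixin Record Coalgebra_isHopfHeap (k : fieldType) C of Coalgebra k C := {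
  heap : tensor (tensor C (cop C)) C -> C;
  heap_morphism : coalg_morphism heap;
  heapA : forall a b c d h : C,
    heap (heap (a \ot (b : cop C) \ot c) \ot (d : cop C) \ot h) =
    heap (a \ot (b : cop C) \ot heap (c \ot (d : cop C) \ot h));
  heapl : forall a c : C,
    sweedler2 (fun c1 c2 : C => heap (c1 \ot (c2 : cop C) \ot a)) c = counit c *: a;
  heapr : forall a c : C,
    sweedler2 (fun c1 c2 : C => heap (a \ot (c1 : cop C) \ot c2)) c = counit c *: a
}.
#[short(type="hopfHeapType")]
HB.structure Definition HopfHeap (k : fieldType) :=
  {C of Coalgebra k C & Coalgebra_isHopfHeap k C}.

Definition bracket (k : fieldType) (C : hopfHeapType k) (a b c : C) : C :=
  heap (a \ot (b : cop C) \ot c).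

Section TensorMul.
Variables (k : fieldType) (A B : algType k).
Local Notation AB := (tensor A B).
Local Notation "s '**' t" := (tensor_mul s t) (at level 40, left associativity).

Lemma tensor_mul_bilin : bilin (@tensor_mul k A B).
Proof. by rewrite /tensor_mul; lin. Qed.

Lemma tensor_mulE (a a' : A) (b b' : B) :
  (a \ot b) ** (a' \ot b') = (a * a') \ot (b * b').
Proof. by rewrite /tensor_mul tliftE ?tliftE //; lin. Qed.

Lemma lin_tensor_mull (V : lmodType k) (g : V -> AB) (t : AB) :
  linear g -> linear (fun x => g x ** t).
Proof. by move=> lg a x y; rewrite lg (tensor_mul_bilin.1 t). Qed.

Lemma lin_tensor_mulr (V : lmodType k) (g : V -> AB) (t : AB) :
  linear g -> linear (fun x => t ** g x).
Proof. by move=> lg a x y; rewrite lg (tensor_mul_bilin.2 t). Qed.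

Lemma tensor_mulA (s t u : AB) : s ** (t ** u) = s ** t ** u.
Proof.
have lid (V : lmodType k) := @lin_id k V.
move: s; apply: tensor_ext => [||a b]; rewrite ?lin_tensor_mull //.
- exact: lin_tensor_mull.
- by apply: lin_tensor_mull; exact: lin_tensor_mull.
move: t; apply: tensor_ext => [||a' b'].
- by apply: lin_tensor_mulr; exact: lin_tensor_mull.
- by apply: lin_tensor_mull; exact: lin_tensor_mulr.
move: u; apply: tensor_ext => [||a'' b''].
- by apply: lin_tensor_mulr; exact: lin_tensor_mulr.
- exact: lin_tensor_mulr.
by rewrite !tensor_mulE !mulrA.
Qed.

Lemma tensor_mul1l (t : AB) : (1 \ot 1) ** t = t.
Proof.
have lid (V : lmodType k) := @lin_id k V.
move: t; apply: tensor_ext => [||a b] //; first exact: lin_tensor_mulr.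
by rewrite tensor_mulE !mul1r.
Qed.

Lemma tensor_mul1r (t : AB) : t ** (1 \ot 1) = t.
Proof.
have lid (V : lmodType k) := @lin_id k V.
move: t; apply: tensor_ext => [||a b] //; first exact: lin_tensor_mull.
by rewrite tensor_mulE !mulr1.
Qed.
End TensorMul.

Ltac hlin :=
  solve [repeat first
    [assumption | match goal with H : _ |- _ => exact: H end
    | apply: lin_tensor_mull | apply: lin_tensor_mulr | lin_step]].

Section AntipodeTheory.
Variables (k : fieldType) (H : hopfAlgType k).
Local Notation S := (@antipode k H).
Local Notation "s '**' t" := (tensor_mul s t) (at level 40, left associativity).

Lemma counit_antipode (x : H) : counit (S x) = counit x.
Proof.
rewrite -{1}(counitr x) linear_sub_tlift; last by lin.
have lc : linear (fun x : H => counit x : k^o) by exact: linearP.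
rewrite (linear_sub_tlift (k := k) (U' := k^o) (h := fun x : H => counit x)) //.
transitivity (tlift (k := k) (U := k^o)
  (fun a b : H => counit (S a * b)) (comul x)).
  by apply: (eq_tlift (k := k) (U := k^o)) => a b; rewrite counitM !linearZ mulrC.
rewrite -(linear_sub_tlift (k := k) (U' := k^o) (h := fun x : H => counit x)) //.
by rewrite antipodel linearZ /= counit1 mulr1.
Qed.

Let R (x : H) : tensor H H := sweedler2 (fun a b => S b \ot S a) x.

Let R_lin (V : lmodType k) (g : V -> H) : linear g -> linear (fun x => R (g x)).
Proof. by move=> lg; rewrite /R /sweedler2; lin. Qed.

Let comul_R (x : H) :
  sweedler2 (fun a b => comul a ** R b) x = counit x *: ((1 : H) \ot (1 : H)).
Proof.
pose G a b (z : H) : tensor H H :=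
  sweedler2 (fun u v => (a * S v) \ot (b * S u)) z.
transitivity (sweedler2 (fun a b => sweedler2 (fun a1 a2 => G a1 a2 b) a) x).
  apply: eq_tlift => a b; rewrite /tensor_mul.
  apply: eq_tlift => a1 a2; rewrite /R tlift_tlift; last by lin.
  by apply: eq_tlift => u v; rewrite tliftE //; lin.
rewrite -sweedler3E; try by rewrite /G /sweedler2; lin.
transitivity (sweedler2 (fun a z => (a * S z) \ot (1 : H)) x); last first.
  rewrite /sweedler2 -(linear_sub_tlift (h := fun y => y \ot 1)); last by lin.
  rewrite antipoder; have := tensZ (counit x) 1 (1 : H) (1 : H).
  by rewrite scale1r mulr1.
apply: eq_tlift => a z.
transitivity (sweedler3 (fun b u v => (a * S v) \ot (b * S u)) z) => //.
rewrite sweedler3E; try lin.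
rewrite -[in RHS](counitl z).
rewrite [RHS](linear_sub_tlift (h := fun y => (a * S y) \ot (1 : H))); last by lin.
apply: eq_tlift => p v.
rewrite /sweedler2 -(linear_sub_tlift (h := fun y => (a * S v) \ot y)); last by lin.
rewrite antipoder linearZ -scalerAr.
have := tensZ (counit p) 1 (a * S v) (1 : H).
have := tensZ 1 (counit p) (a * S v) (1 : H).
by rewrite !scale1r mulr1 mul1r => -> ->.
Qed.

Lemma comul_antipode (x : H) :
  comul (S x) = sweedler2 (fun a b => S b \ot S a) x.
Proof.
have lid (V : lmodType k) := @lin_id k V.
pose F a b c := comul (S a) ** comul b ** R c.
have E : sweedler3 F x = sweedler2 (fun a b => sweedler2 (fun a1 a2 => F a1 a2 b) a) x.
  by apply: sweedler3E => a b; rewrite /F;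
    repeat first [exact: R_lin | apply: lin_tensor_mull | apply: lin_tensor_mulr | lin_step].
transitivity (sweedler3 F x).
  rewrite -{1}(counitr x) !linear_sub_tlift; try lin.
  apply: eq_tlift => a b.
  transitivity (comul (S a) ** sweedler2 (fun b1 b2 => comul b1 ** R b2) b).
    rewrite comul_R !linearZ (linearZ_of _ ((@tensor_mul_bilin _ H H).2 _)).
    by rewrite tensor_mul1r.
  rewrite /sweedler2 linear_sub_tlift; last exact: lin_tensor_mulr.
  by apply: eq_tlift => b1 b2; rewrite tensor_mulA.
rewrite E -[in RHS](counitl x) -/(R _).
rewrite linear_sub_tlift; last exact: R_lin.
apply: eq_tlift => a b; rewrite (linearZ_of _ (R_lin (lid H))).
transitivity (sweedler2 (fun a1 a2 => comul (S a1) ** comul a2) a ** R b).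
  rewrite /sweedler2 (linear_sub_tlift (h := fun t => t ** R b)) //.
  exact: lin_tensor_mull.
suff -> : sweedler2 (fun a1 a2 => comul (S a1) ** comul a2) a =
    counit a *: ((1 : H) \ot (1 : H)).
  rewrite (linearZ_of _ ((@tensor_mul_bilin _ H H).1 _)).
  by rewrite tensor_mul1l.
rewrite -comul1 -linearZ -antipodel linear_sub_tlift; last by lin.
by apply: eq_tlift => u v; rewrite comulM.
Qed.
End AntipodeTheory.

Definition Hp (H : Type) : Type := H.

Section HopfHeapOfHopfAlgebra.
Variables (k : fieldType) (H : hopfAlgType k).
Local Notation S := (@antipode k H).
HB.instance Definition _ := Coalgebra.copy (Hp H) H.

(* The linear map induced by a (x) b (x) c |-> a S(b) c. *)
Definition Hp_heap (t : tensor (tensor (Hp H) (cop (Hp H))) (Hp H)) : Hp H :=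
  tlift (fun u (c : H) => tlift (fun a b : H => a * S b) u * c) t.

Lemma Hp_heapE (a b c : H) :
  Hp_heap ((a : Hp H) \ot (b : cop (Hp H)) \ot (c : Hp H)) = a * S b * c.
Proof. by rewrite /Hp_heap tliftE ?tliftE //; lin. Qed.

Fact Hp_heap_morphism : coalg_morphism Hp_heap.
Proof.
have lh (V : lmodType k) (g : V -> tensor (tensor (Hp H) (cop (Hp H))) (Hp H)) :
    linear g -> linear (fun x => Hp_heap (g x)) by rewrite /Hp_heap => lg; lin.
have lid := @lin_id k; split; first exact: lh.
- have bh : bilin (fun u v => Hp_heap u \ot Hp_heap v).
    by split=> ?; [apply: lin_tensl|apply: lin_tensr]; exact: lh.
  rewrite /sweedler2; apply: tensor_ext => [||u c].
  + by apply: lin_app; exact: lh.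
  + by apply: lin_tliftt => //; apply: lin_app.
  move: u; apply: tensor_ext => [||a b].
  + by apply: lin_app; apply: lh; apply: lin_tensl.
  + by apply: lin_tliftt => //; apply: lin_app; apply: lin_tensl.
  rewrite Hp_heapE -/(sweedler2 _ _) sweedler2_tens //.
  rewrite sweedler2_tens; last first.
    split=> ?; rewrite /sweedler2; apply: lin_tliftf => ? ?.
      by apply: lin_tensl; apply: lh; apply: lin_tensl.
    by apply: lin_tensr; apply: lh; apply: lin_tensl.
  transitivity (comul ((a : H) * S b * c)) => //.
  rewrite !comulM comul_antipode.
  transitivity (sweedler2 (fun a1 a2 : H => sweedler2 (fun b1 b2 : H =>
      sweedler2 (fun c1 c2 : H => (a1 * S b2 * c1) \ot (a2 * S b1 * c2)) (c : H))
      (b : H)) (a : H)).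
    rewrite /tensor_mul tlift_tlift; last by lin.
    apply: eq_tlift => a1 a2; rewrite tlift_tlift; last by lin.
    rewrite tlift_tlift; last by lin.
    apply: eq_tlift => b1 b2; rewrite tliftE; last by lin.
    by rewrite tliftE; last by lin.
  apply: (@eq_tlift k (Hp H) (Hp H)) => a1 a2; rewrite sweedler2_cop; last first.
    split=> ?; rewrite /sweedler2; apply: lin_tliftf => ? ?.
      by apply: lin_tensl; apply: lh; apply: lin_tensl; apply: lin_tensr.
    by apply: lin_tensr; apply: lh; apply: lin_tensl; apply: lin_tensr.
  apply: (@eq_tlift k (Hp H) (Hp H)) => b1 b2.
  by apply: (@eq_tlift k (Hp H) (Hp H)) => c1 c2; rewrite !Hp_heapE.
- move=> t; apply: (@tensor_ext k _ _ k^o (fun t => counit (Hp_heap t)) counit).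
  + by move=> a x y; rewrite (lh _ id) // linearP.
  + exact: linearP.
  move=> u c; move: u.
  apply: (@tensor_ext k _ _ k^o (fun u => counit (Hp_heap (u \ot c)))
    (fun u => counit (u \ot c))).
  + by move=> a x y; rewrite linear_tensl (lh _ id) // linearP.
  + by move=> a x y; rewrite linear_tensl linearP.
  move=> a b; rewrite Hp_heapE !counit_tens.
  transitivity (counit ((a : H) * S b * c)) => //.
  by rewrite !counitM counit_antipode.
Qed.

Fact Hp_heapA (a b c d h : Hp H) :
  Hp_heap (Hp_heap (a \ot (b : cop (Hp H)) \ot c) \ot (d : cop (Hp H)) \ot h) =
  Hp_heap (a \ot (b : cop (Hp H)) \ot Hp_heap (c \ot (d : cop (Hp H)) \ot h)).
Proof. by rewrite !Hp_heapE !mulrA. Qed.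

Fact Hp_heapl (a c : Hp H) :
  sweedler2 (fun c1 c2 : Hp H => Hp_heap (c1 \ot (c2 : cop (Hp H)) \ot a)) c =
  counit c *: a.
Proof.
transitivity (sweedler2 (fun c1 c2 : H => c1 * S c2 * (a : H)) (c : H)).
  by apply: (@eq_tlift k (Hp H) (Hp H) (Hp H)) => c1 c2; exact: Hp_heapE.
rewrite /sweedler2 -(linear_sub_tlift (h := fun y : H => y * (a : H))); last by lin.
by rewrite antipoder -scalerAl mul1r.
Qed.

Fact Hp_heapr (a c : Hp H) :
  sweedler2 (fun c1 c2 : Hp H => Hp_heap (a \ot (c1 : cop (Hp H)) \ot c2)) c =
  counit c *: a.
Proof.
transitivity (sweedler2 (fun c1 c2 : H => (a : H) * (S c1 * c2)) (c : H)).
  by apply: (@eq_tlift k (Hp H) (Hp H) (Hp H)) => c1 c2; rewrite Hp_heapE mulrA.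
rewrite /sweedler2 -(linear_sub_tlift (h := fun y : H => (a : H) * y)); last by lin.
by rewrite antipodel -scalerAr mulr1.
Qed.

HB.instance Definition _ := Coalgebra_isHopfHeap.Build k (Hp H)
  Hp_heap_morphism Hp_heapA Hp_heapl Hp_heapr.

Lemma Hp_bracketE (a b c : H) :
  bracket (a : Hp H) (b : Hp H) (c : Hp H) = a * S b * c.
Proof. exact: Hp_heapE. Qed.
End HopfHeapOfHopfAlgebra.

Definition rota_baxter_cooperator (k : fieldType) (H : comHopfAlgType k)
    (B : H -> H) : Prop :=
  [/\ linear B, B 1 = 1, {morph B : x y / x * y}
    & forall x : H,
        sweedler2 (fun x1 x2 => B x1 \ot B x2) x =
        sweedler4 (fun y1 y2 y3 y4 => (y1 * B (y2 * antipode y4)) \ot y3) (B x)].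

Definition rota_baxter_operator (k : fieldType) (C : hopfHeapType k)
    (B : C -> C) : Prop :=
  [/\ linear B,
      forall a b c : C, B (bracket a b c) = bracket (B a) (B b) (B c)
    & forall a : C,
        sweedler2 (fun a1 a2 => B a1 \ot B a2) a =
        sweedler4 (fun y1 y2 y3 y4 => bracket y1 (B y4) (B y2) \ot y3) (B a)].

(* Main.v *)
Require Import Defs.
From mathcomp Require Import all_boot all_order all_algebra.

Set Implicit Arguments.
Unset Strict Implicit.
Unset Printing Implicit Defensive.

Import GRing.Theory.
Local Open Scope ring_scope.

(** An algebra map [B] commuting with the antipode S preserves a S(b) c. The two comultiplication
    conditions then agree term by term: B(y2 S(y4)) = B(y2) S(B(y4)), and commutativity of [H] turns
    this into S(B(y4)) B(y2), as the bracket requires. *)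

Theorem proposition5p6 (k : fieldType) (H : comHopfAlgType k) (B : H -> H)
    (hB : rota_baxter_cooperator B)
    (hSB : antipode \o B =1 B \o antipode) :
  @rota_baxter_operator k (Hp H) B.
Proof.
case: hB => B_lin _ BM B_comul.
have SB (x : H) : B (antipode x) = antipode (B x) by rewrite [RHS]hSB.
split=> // [a b c | a].
  by rewrite [X in B X]Hp_bracketE [RHS]Hp_bracketE !BM SB.
rewrite [LHS]B_comul.
(* Both sides expand the same iterated coproduct of [B a], as [Hp H] has the coalgebra structure of
   [H]; only the first tensor factors differ. *)
apply: (@eq_tlift k H H) => y1 z; apply: (@eq_tlift k H H) => y2 w.
apply: (@eq_tlift k H H) => y3 y4; congr (_ \ot _).
by rewrite [RHS]Hp_bracketE BM SB [B y2 * _]mulrC mulrA.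
Qed.
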